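(* Let $J = \{J_l : 1 \le l \le N\}$ be a partition of $\mathbb{T}$ into finitely many intervals, each of length strictly less than $1/2$. Suppose that $\alpha \in \mathbb{T}$ is a Roth number. Then $R(s(\alpha,\beta,\gamma,J)) = T(s(\alpha,\beta,\gamma,J)) = 1$ for every $(\beta,\gamma) \in \mathbb{T}^2$.
   Context: $\mathbb{T} = \mathbb{R}/\mathbb{Z}$, and $\langle x \rangle = \mathrm{dist}(x,\mathbb{Z})$. $\alpha \in \mathbb{T}$ is a Roth number if for every $\varepsilon > 0$ there is a constant $c(\varepsilon) > 0$ such that $\langle q\alpha \rangle > \frac{c(\varepsilon)}{q^{1+\varepsilon}}$ for every positive integer $q$. For $(\alpha,\beta,\gamma) \in \mathbb{T}^3$, $s(\alpha,\beta,\gamma,J) = (s_n)_{n\in\mathbb{Z}}$ denotes the coding of $\alpha n^2 + \beta n + \gamma$ (in $\mathbb{T}$) with respect to $J$, i.e. $s_n = \sum_{l=1}^N \lambda_l \chi_{J_l}(\alpha n^2 + \beta n + \gamma)$ with distinct numbers $\lambda_1,\ldots,\lambda_N$. For a two-sided sequence $\omega = (\omega_k)_{k\in\mathbb{Z}}$ over a finite alphabet and $n \ge 1$, let $R_n(\omega) = 1 + \frac{1}{n} \sup \{ m : \omega_k = \omega_{k+n} \text{ for } 1 \le k \le m \}$ and $T_n(\omega) = 1 + \frac{1}{n} \sup \{ m : \omega_k = \omega_{k+n} \text{ and } \omega_{n+1-k} = \omega_{1-k} \text{ for } 1 \le k \le m \}$, where $m$ ranges over positive integers and $\sup\emptyset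 = 0$; set $R(\omega) = \limsup_{n\to\infty} R_n(\omega)$ and $T(\omega) = \limsup_{n\to\infty} T_n(\omega)$, elements of $[1,\infty]$. *)

(* Defs.v *)
From HB Require Import structures.
From mathcomp Require Import all_boot all_order all_algebra.
From mathcomp Require Import all_classical all_reals all_analysis.
Set Implicit Arguments.
Unset Strict Implicit.
Unset Printing Implicit Defensive.
Import Order.TTheory GRing.Theory Num.Theory.
Local Open Scope classical_set_scope.
Local Open Scope ring_scope.
Local Open Scope quotient_scope.

(* Num.int_num_subdef is the predicate underlying the qualifier Num.int. *)
Definition int_subgroup (R : realType) : zmodClosed R :=
  GRing.ZmodClosed.clone R (@Num.int_num_subdef R) _.

(* R / Z, as an additive group. *)
Notation circle R := (@Quotient.quot _ (int_subgroup R)).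

Section Circle.
Variable R : realType.

Definition dist_int (x : R) : R := inf [set `|x - k%:~R| | k in [set: int]].

Definition circle_norm (x : circle R) : R := dist_int (repr x).

Lemma dist_intDz (x : R) (j : int) : dist_int (x + j%:~R) = dist_int x.
Proof.
congr inf; apply/seteqP; split=> _ [k _ <-].
  by exists (k - j) => //; rewrite intrB opprB [_%:~R - _]addrC addrA addrAC.
by exists (k + j) => //; rewrite intrD opprD addrACA subrr addr0.
Qed.

Lemma circle_normE (x : R) : circle_norm (\pi_(circle R) x) = dist_int x.
Proof.
rewrite /circle_norm.
have /eqP : \pi_(circle R) (repr (\pi_(circle R) x)) = \pi x by rewrite reprK.
rewrite -Quotient.idealrBE => /intrP[j hj].
by rewrite -(subrK x (repr _)) hj addrC dist_intDz.
Qed.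

Definition Roth_number (alpha : circle R) : Prop :=
  forall e : R, 0 < e -> exists2 c : R, 0 < c &
    forall q : nat, (0 < q)%N ->
      c / (q%:R `^ (1 + e)) < circle_norm (alpha *+ q).

(* A is an interval of the circle of length len: the projection of a bounded
   real interval, open or closed at either end, whose length is len. The bound
   len <= 1 makes len unique: a longer interval would wrap around. *)
Definition circle_arc (A : set (circle R)) (len : R) : Prop :=
  exists (a b : R) (ba bb : bool),
    [/\ a <= b, len = b - a, len <= 1 &
        A = \pi_(circle R) @` [set` Interval (BSide ba a) (BSide bb b)]].

Definition quad_coding (K : numFieldType) (N : nat) (lam : 'I_N -> K)
    (J : 'I_N -> set (circle R)) (alpha beta gamma : circle R) (n : int) : K :=
  \sum_(l < N) lam l * \1_(J l) (alpha *~ (n ^+ 2) + beta *~ n + gamma).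

End Circle.

Section Repetitions.
Variables (R : realType) (A : Type).
Local Open Scope ereal_scope.

(* Adding 0 encodes the convention that the supremum of the empty set is 0. *)
Definition sup_nat (S : set nat) : \bar R :=
  ereal_sup (0 |` [set m%:R%:E | m in S]).

Definition rep_n (w : int -> A) (n : nat) : \bar R :=
  1 + (n%:R^-1)%:E * sup_nat [set m | (0 < m)%N /\
    forall k : nat, (1 <= k <= m)%N -> w k%:Z = w (k%:Z + n%:Z)%R].

Definition pinned_rep_n (w : int -> A) (n : nat) : \bar R :=
  1 + (n%:R^-1)%:E * sup_nat [set m | (0 < m)%N /\
    forall k : nat, (1 <= k <= m)%N ->
      w k%:Z = w (k%:Z + n%:Z)%R /\
      w (n%:Z + 1 - k%:Z)%R = w (1 - k%:Z)%R].

(* The limits superior are insensitive to the junk value at n = 0. *)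
Definition rep (w : int -> A) : \bar R := limn_esup (rep_n w).

Definition pinned_rep (w : int -> A) : \bar R := limn_esup (pinned_rep_n w).

End Repetitions.
Arguments rep R {A} w.
Arguments pinned_rep R {A} w.

(* Main.v *)
Require Import Defs.
From mathcomp Require Import all_boot all_order all_algebra.
From mathcomp Require Import all_classical all_reals all_analysis.
From mathcomp Require Import ring lra zify.
Import Order.TTheory GRing.Theory Num.Theory.
Import numFieldNormedType.Exports.
Local Open Scope classical_set_scope.
Local Open Scope ring_scope.
Local Open Scope quotient_scope.

Set Implicit Arguments.
Unset Strict Implicit.
Unset Printing Implicit Defensive.

(** Write [s_k = alpha k^2 + beta k + gamma], and suppose that the coding has the
    same letters at [k] and [k + n] for [1 <= k <= m] with [m >= eta n]. The
    displacement [s_(k+n) - s_k] is affine in [k], with slope [2 alpha n], and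
    modulo 1 it stays within the maximal arc length [L < 1/2], since both points
    lie in a common arc.

    By Dirichlet some multiple [q * 2 alpha n], with [q] bounded, is within
    [1 - 2L] of an integer. Along progressions of step [q] the displacement can
    therefore not jump over the gap between [L] and [1 - L], and it is a genuine
    affine sequence with values in [-L, L] ([no_jump]). Its slope is small, but
    the Roth property makes it at least [n^(-1-e)] up to a constant; hence over
    a range of [H ~ n] steps the displacement has, on some quarter of the range,
    a constant sign and a size of at least [c n^(-e)] ([linear_quarter]).

    On that quarter the points themselves form again a quadratic sequence, with
    leading coefficient [q^2 alpha]. Such a sequence of length [H] is
    [n^(-e)]-dense in the circle, with room to spare ([quadratic_hits] and
    [roth_quadratic_hits], by the Weyl and Fejer arguments). So it meets any arc
    of positive length closer to its end, on the side to which the displacement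
    points, than the displacement is long: the displaced point leaves the arc,
    and, as [2L < 1], does not come back into it from the other side
    ([displacement_escape]). The letters at [k] and [k + n] then differ, a
    contradiction.

    Hence the length of a repetition is at most [eta n] for [n] large
    ([short_repetitions]), for every [eta > 0]. A pinned repetition is in
    particular a repetition, so both limits superior are 1. *)

(** * Distance to the integers and trigonometric sums *)

Lemma dist_int_has_inf (R : realType) (x : R) :
  has_inf [set `|x - k%:~R| | k in [set: int]].
Proof.
split; first by exists `|x - 0%:~R|; exists 0.
by exists 0 => _ [k _ <-].
Qed.

Lemma dist_int_le (R : realType) (x : R) (k : int) :
  dist_int x <= `|x - k%:~R|.
Proof. by apply: ge_inf; [case: (dist_int_has_inf x)|exists k]. Qed.

Lemma dist_int_lt (R : realType) (x d : R) :
  dist_int x < d -> exists k : int, `|x - k%:~R| < d.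
Proof.
move=> /(inf_lt (dist_int_has_inf x).1) [_ [k _ <-] kd]; by exists k.
Qed.

(** A weak Jordan inequality: halve the angle, use [sin t >= t cos t] from the
    mean value theorem, and [2 cos (y / 2) ^+ 2 = 1 + cos y >= 1]. *)
Lemma ler_half_sin (R : realType) (y : R) : 0 <= y <= pi / 2 -> y / 2 <= sin y.
Proof.
move=> /andP[y0 ypi]; have pi2 := pihalf_lt2 R.
have y20 : 0 <= y / 2 by lra.
have [z zin] : exists2 z : R, z \in `[0, y / 2] &
    sin (y / 2) - sin 0 = cos z * (y / 2 - 0).
  apply: MVT_segment => //.
  by apply: continuous_subspaceT => x; exact: continuous_sin.
rewrite sin0 !subr0 => sinE.
move: zin; rewrite in_itv /= => /andP[z0 zy].
have cosz : cos (y / 2) <= cos z.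
  by rewrite leNgt ltr_cos ?in_itv /= -?leNgt //; lra.
have cosy : 0 <= cos y by apply: cos_ge0_pihalf; lra.
have := cos_mulr2n (y / 2); have := sin_mulr2n (y / 2).
have -> : (y / 2) *+ 2 = y by rewrite -mulr_natr divfK.
rewrite sinE => -> cos2.
have c0 : 0 <= cos (y / 2) by apply: cos_ge0_pihalf; lra.
have -> : (cos (y / 2) * (cos z * (y / 2))) *+ 2
        = (cos (y / 2) * cos z) * y by lra.
have : cos (y / 2) ^+ 2 <= cos (y / 2) * cos z by rewrite expr2 ler_wpM2l.
nra.
Qed.

Lemma sinDzpi (R : realType) (x : R) (k : int) :
  `|sin (x + k%:~R * pi)| = `|sin x|.
Proof.
have nat_case (y : R) (n : nat) : `|sin (y + n%:R * pi)| = `|sin y|.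
  by rewrite mulr_natl (alternatingn (@sinDpi R)) normrM normrX normrN1 expr1n mul1r.
case: k => n; first by rewrite nat_case.
by rewrite NegzE mulrNz -(nat_case _ n.+1) mulNr subrK.
Qed.

(** Converts Diophantine information into lower bounds for the denominators of
    geometric sums. *)
Lemma dist_int_le_sin (R : realType) (x : R) :
  dist_int x <= `|sin (pi * x)|.
Proof.
pose k := Num.floor (x + 1/2); pose y := x - k%:~R.
have ky : - (1/2) <= y < 1/2.
  rewrite /y; have := floor_itv (x + 1/2); rewrite -/k intrD1; lra.
have -> : `|sin (pi * x)| = `|sin (pi * `|y|)|.
  have -> : `|sin (pi * `|y|)| = `|sin (pi * y)|.
    by case: (ger0P y) => // _; rewrite mulrN sinN normrN.
  by rewrite -(sinDzpi (pi * y) k) [_%:~R * _]mulrC -mulrDr subrK.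
apply: le_trans (dist_int_le x k) _; rewrite -/y.
apply: le_trans (ler_norm _).
have y1 : `|y| <= 1/2 by rewrite ler_norml; lra.
have y0 := normr_ge0 y; have p2 := pi_ge2 R.
apply: le_trans (ler_half_sin _); nra.
Qed.

(** Multiplication by [2 * sin (v / 2)] makes the sum telescope. The phase [u]
    is free, so that the same bound covers sines and the shifted phases coming
    from Weyl differencing. *)
Lemma linear_cos_sum (R : realType) (n : nat) (u v : R) :
  `|\sum_(i < n) cos (u + i%:R * v)| * `|sin (v / 2)| <= 1.
Proof.
have tel : 2 * sin (v / 2) * (\sum_(i < n) cos (u + i%:R * v))
    = sin (u - v / 2 + n%:R * v) - sin (u - v / 2).
  elim: n => [|n IHn]; first by rewrite big_ord0 mul0r addr0 mulr0 subrr.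
  rewrite big_ord_recr /= mulrDr IHn -[n.+1%:R]natr1.
  have -> : u - v / 2 + n%:R * v = (u + n%:R * v) - v / 2 by ring.
  have -> : u - v / 2 + (n%:R + 1) * v = (u + n%:R * v) + v / 2 by field.
  rewrite [sin (_ + v / 2)]sinD [sin (u + _ - v/2)]sinB; ring.
rewrite -normrM mulrC.
have := sin_max (u - v / 2 + n%:R * v); have := sin_max (u - v / 2).
rewrite !ler_norml => h1 h2; lra.
Qed.

(** The squared modulus of an exponential sum, written without complex
    numbers. *)
Lemma sqr_cos_sin_sum (R : realType) (n : nat) (f : nat -> R) :
  (\sum_(i < n) cos (f i)) ^+ 2 + (\sum_(i < n) sin (f i)) ^+ 2
  = \sum_(i < n) \sum_(j < n) cos (f i - f j).
Proof.
rewrite !expr2 !mulr_suml -big_split /=; apply: eq_bigr => i _.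
by rewrite !mulr_sumr -big_split /=; apply: eq_bigr => j _; rewrite cosB.
Qed.

(** The unnormalised Fejer kernel decays like the inverse square of the distance
    to the integers: it is the squared modulus of a geometric sum. *)
Lemma fejer_bound (R : realType) (n : nat) (t : R) :
  (\sum_(i < n) \sum_(j < n) cos (i%:R * t - j%:R * t)) * sin (t / 2) ^+ 2 <= 2.
Proof.
rewrite -(@sqr_cos_sin_sum R n (fun i => i%:R * t)).
set C := \sum_(i < n) _; set S := \sum_(i < n) _; set s := sin _.
have /[!ler_norml] hc : `|C * s| <= 1.
  have := linear_cos_sum n 0 t; rewrite -normrM; congr (`|_ * _| <= _).
  by apply: eq_bigr => i _; rewrite add0r.
have /[!ler_norml] hs : `|S * s| <= 1.
  have := linear_cos_sum n (- (pi / 2)) t; rewrite -normrM; congr (`|_ * _| <= _).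
  by apply: eq_bigr => i _; rewrite addrC cosBpihalf.
rewrite mulrDl -!exprMn.
nra.
Qed.

(** Grouping the pairs by their difference [h], as Weyl differencing requires. *)
Lemma sum_symmetric_square (R : realType) (n : nat) (G : nat -> nat -> R) :
  (forall i j, G i j = G j i) ->
  \sum_(i < n) \sum_(j < n) G i j = \sum_(i < n) G i i
    + 2 * \sum_(1 <= h < n) \sum_(i < n - h) G (i + h)%N i.
Proof.
move=> Gsym; elim: n => [|n IHn]; first by rewrite big_geq // !big_ord0 mulr0 addr0.
rewrite big_ord_recr /=; under eq_bigr do rewrite big_ord_recr /=.
rewrite big_split /= {}IHn.
have -> : \sum_(i < n) G i n = \sum_(j < n) G n j by apply: eq_bigr => i _.
rewrite !big_ord_recr /=.
have -> : \sum_(1 <= h < n.+1) \sum_(i < n.+1 - h) G (i + h)%N i =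
   \sum_(1 <= h < n) (\sum_(i < n - h) G (i + h)%N i) + \sum_(j < n) G n j.
  case: n => [|n]; first by rewrite !big_geq // big_ord0 addr0.
  rewrite big_nat_recr //= subSn // subnn big_ord1 add0n.
  have -> : \sum_(j < n.+1) G n.+1 j = \sum_(1 <= h < n.+1) G n.+1 (n.+1 - h)%N + G n.+1 0%N.
    rewrite -(big_mkord xpredT (G n.+1)) big_nat_recl // addrC; congr (_ + _).
    rewrite [RHS]big_nat_rev /= [RHS]big_add1 /=.
    apply: eq_big_nat => i /andP[_ i_n]; congr (G _ _); lia.
  rewrite addrA; congr (_ + _); rewrite -big_split /=.
  apply: eq_big_nat => h /andP[h1 hn]; rewrite subSn 1?ltnW // big_ord_recr /=.
  by rewrite subnK // ltnW.
ring.
Qed.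

(** * Weyl differencing and density of quadratic sequences *)

(** Each block of length [t0] contains at most one bad index, so [h %/ t0] is
    injective on the bad indices. *)
Lemma sparse_count (bad : pred nat) (H t0 : nat) : (0 < t0)%N ->
  (forall h h', bad h -> bad h' -> (h < h')%N -> (t0 <= h' - h)%N) ->
  (\sum_(1 <= h < H) bad h <= (H %/ t0).+1)%N.
Proof.
move=> t0_gt0 sep.
have -> : (\sum_(1 <= h < H) bad h)%N = count bad (index_iota 1 H).
  by rewrite -sum1_count [RHS]big_mkcond; apply: eq_bigr => h _; case: (bad h).
rewrite -size_filter.
set s := (X in (size X <= _)%N).
have inj : {in s &, injective (fun h => h %/ t0)}%N.
  move=> h h'; rewrite !mem_filter => /andP[bh _] /andP[bh' _] /= e.
  have := ltn_pmod h t0_gt0; have := ltn_pmod h' t0_gt0.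
  have := divn_eq h t0; have := divn_eq h' t0; rewrite e.
  case: (ltngtP h h') => // hh; [have := sep _ _ bh bh' hh|have := sep _ _ bh' bh hh]; lia.
rewrite -(size_map (fun h => h %/ t0)%N) -(size_iota 0 (H %/ t0).+1).
apply: uniq_leq_size.
  by rewrite map_inj_in_uniq // filter_uniq // iota_uniq.
move=> _ /mapP[h + ->]; rewrite mem_filter mem_index_iota mem_iota => /andP[_ /andP[_ hH]].
by rewrite leq0n /= add0n ltnS leq_div2r // ltnW.
Qed.

Lemma dist_int_sub_lt (R : realType) (x y d e : R) :
  dist_int x < d -> dist_int y < e -> dist_int (x - y) < d + e.
Proof.
move=> /dist_int_lt[k xk] /dist_int_lt[l yl].
apply: le_lt_trans (dist_int_le _ (k - l)) _.
have -> : x - y - (k - l)%:~R = (x - k%:~R) - (y - l%:~R) by rewrite intrB; ring.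
by apply: le_lt_trans (ler_normB _ _) _; rewrite ltrD.
Qed.

Definition quadratic_phase (R : realType) (A be ga : R) (i : nat) : R :=
  2 * pi * (A * i%:R ^+ 2 + be * i%:R + ga).

(** Weyl differencing. For each difference [h] the phase is linear with slope
    [2 * A * h], so the inner sum is at most [1 / d] unless [2 * A * h] is within
    [d] of an integer. Two such bad [h] cannot differ by less than [t0], for
    otherwise their difference would violate the separation hypothesis; there
    are thus at most [H / t0 + 1] of them, each bounded trivially by [H]. *)
Lemma weyl_difference (R : realType) (H t0 : nat) (A be ga d : R) :
  0 < d -> (0 < t0)%N ->
  (forall t, (0 < t < t0)%N -> 2 * d <= dist_int (2 * A * t%:R)) ->
  \sum_(i < H) \sum_(j < H)
    cos (quadratic_phase A be ga i - quadratic_phase A be ga j)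
    <= H%:R * (3 + 2 * (H%:R / t0%:R) + 2 / d).
Proof.
move=> d0 t0_gt0 sep; set f := quadratic_phase A be ga.
rewrite (@sum_symmetric_square _ H (fun i j => cos (f i - f j))); last first.
  by move=> i j; rewrite -cosN opprB.
under eq_bigr do rewrite subrr cos0; rewrite sumr_const card_ord.
pose bad h := dist_int (2 * A * h%:R) < d.
have each h : (1 <= h < H)%N ->
    \sum_(i < H - h) cos (f (i + h)%N - f i) <= (bad h)%:R * H%:R + d^-1.
  move=> /andP[h1 hH].
  have [bh|gh] := boolP (bad h).
    rewrite mul1r; apply: le_trans (_ : H%:R <= _); last by rewrite lerDl invr_ge0 ltW.
    apply: le_trans (_ : \sum_(i < H - h) 1 <= _).
      by apply: ler_sum => i _; exact: cos_le1.
    by rewrite sumr_const card_ord ler_nat leq_subr.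
  rewrite mul0r add0r; move: gh; rewrite /bad -leNgt => gh.
  pose u := 2 * pi * (A * h%:R ^+ 2 + be * h%:R).
  pose v := 2 * (pi * (2 * A * h%:R)).
  have -> : \sum_(i < H - h) cos (f (i + h)%N - f i)
          = \sum_(i < H - h) cos (u + i%:R * v).
    by apply: eq_bigr => i _; congr cos; rewrite /f /quadratic_phase /u /v natrD; ring.
  have := linear_cos_sum (H - h) u v.
  have -> : v / 2 = pi * (2 * A * h%:R) by rewrite /v; field.
  have := le_trans gh (dist_int_le_sin _).
  set s := `|sin _|; set S := \sum_(i < _) _ => ds Ss.
  apply: le_trans (ler_norm _) _.
  rewrite -[d^-1]mul1r ler_pdivlMr //; apply: le_trans Ss.
  by rewrite ler_wpM2l.
have nbad : (\sum_(1 <= h < H) bad h <= (H %/ t0).+1)%N.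
  apply: sparse_count => // h h' bh bh' hh; rewrite leqNgt; apply/negP => lt0.
  have := sep (h' - h)%N; rewrite lt0 subn_gt0 hh => /(_ isT).
  rewrite natrB ?(ltnW hh) // mulrBr leNgt.
  have -> : 2 * d = d + d by ring.
  by rewrite dist_int_sub_lt.
have tot : \sum_(1 <= h < H) \sum_(i < H - h) cos (f (i + h)%N - f i)
    <= (H%:R / t0%:R + 1) * H%:R + H%:R / d.
  apply: le_trans (ler_sum_nat each) _.
  rewrite big_split /= -mulr_suml -natr_sum sumr_const_nat.
  apply: lerD; last first.
    by rewrite -[leLHS]mulr_natl ler_wpM2r ?invr_ge0 ?(ltW d0) // ler_nat leq_subr.
  rewrite ler_wpM2r //.
  apply: le_trans (_ : ((H %/ t0).+1)%:R <= _); first by rewrite ler_nat.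
  rewrite -natr1 lerD2r ler_pdivlMr ?ltr0n // -natrM ler_nat.
  exact: leq_trunc_div.
move: tot; set X := \sum_(1 <= h < H) _ => tot.
have -> : H%:R * (3 + 2 * (H%:R / t0%:R) + 2 / d) = H%:R + 2 * ((H%:R / t0%:R + 1) * H%:R + H%:R / d) :> R.
  by field; rewrite (gt_eqF d0) pnatr_eq0 -lt0n.
by rewrite lerD2l ler_pM2l.
Qed.

Lemma weyl_cos_sum (R : realType) (H t0 : nat) (A be ga d M : R) :
  0 < d -> (0 < t0)%N ->
  (forall t, (0 < t < t0)%N -> 2 * d <= dist_int (2 * A * t%:R)) ->
  0 <= M -> H%:R * (3 + 2 * (H%:R / t0%:R) + 2 / d) <= M ^+ 2 ->
  `|\sum_(i < H) cos (quadratic_phase A be ga i)| <= M.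
Proof.
move=> d0 t00 sep M0 HM.
have := le_trans (weyl_difference H be ga d0 t00 sep) HM.
rewrite -(sqr_cos_sin_sum H (quadratic_phase A be ga)).
set C := \sum_(i < H) _; set S := \sum_(i < H) _ => CSM.
rewrite -(ler_pXn2r (n := 2)) ?nnegrE // real_normK ?num_real //.
by apply: le_trans CSM; rewrite lerDl sqr_ge0.
Qed.

(** Quantitative density of a quadratic sequence. If no term came within [w] of
    [u], the Fejer kernel of order [D] centred at [u], summed over the sequence,
    would be at most [2 * H / w ^+ 2]. But its diagonal part alone is [D * H],
    and the other frequencies, all below [D], cancel up to a quarter of this by
    the Weyl bound; this is contradictory once [D * w ^+ 2 >= 8]. *)
Lemma quadratic_hits (R : realType) (D H t0 : nat) (A be ga u w d : R) :
  0 <= w -> 8 <= D%:R * w ^+ 2 -> 0 < d -> (0 < t0)%N -> (0 < H)%N ->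
  (forall a t, (0 < a < D)%N -> (0 < t < t0)%N ->
     2 * d <= dist_int (2 * A * (a * t)%:R)) ->
  16 * D%:R ^+ 2 * (3 + 2 * (H%:R / t0%:R) + 2 / d) <= H%:R ->
  exists2 i, (i < H)%N & dist_int (A * i%:R ^+ 2 + be * i%:R + ga - u) < w.
Proof.
move=> w0 Dw d0 t00 H0 sep HD.
have [//|nohit] := pselect (exists2 i, (i < H)%N &
  dist_int (A * i%:R ^+ 2 + be * i%:R + ga - u) < w).
have far i : (i < H)%N -> w <= dist_int (A * i%:R ^+ 2 + be * i%:R + ga - u).
  by move=> iH; rewrite leNgt; apply/negP => ?; apply: nohit; exists i.
have D0 : 0 < D%:R :> R.
  rewrite ltr0n lt0n; apply/eqP => D0; move: Dw; rewrite D0 mul0r; lra.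
have HR0 : 0 < H%:R :> R by rewrite ltr0n.
pose tau := quadratic_phase A be (ga - u).
pose E := \sum_(i < H) \sum_(j < D) \sum_(k < D) cos (j%:R * tau i - k%:R * tau i).
have upper : E * w ^+ 2 <= 2 * H%:R.
  rewrite /E mulr_suml mulr_natr -[X in _ <= _ *+ X]card_ord -sumr_const.
  apply: ler_sum => i _; apply: le_trans (fejer_bound D (tau i)).
  apply: ler_wpM2l.
    rewrite -(@sqr_cos_sin_sum R D (fun j => j%:R * tau i)).
    by rewrite addr_ge0 ?sqr_ge0.
  rewrite -[leRHS]real_normK ?num_real // ler_pXn2r ?nnegrE //.
  apply: le_trans (far i (ltn_ord i)) _; apply: le_trans (dist_int_le_sin _) _.
  by rewrite le_eqVlt; apply/orP; left; apply/eqP; congr `|sin _|; rewrite /tau /quadratic_phase; field.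
have freq a : (0 < a < D)%N ->
    `|\sum_(i < H) cos (a%:R * tau i)| <= H%:R / (4 * D%:R).
  move=> aD.
  have -> : \sum_(i < H) cos (a%:R * tau i) = \sum_(i < H)
      cos (quadratic_phase (a%:R * A) (a%:R * be) (a%:R * (ga - u)) i).
    by apply: eq_bigr => i _; congr cos; rewrite /tau /quadratic_phase; ring.
  apply: (@weyl_cos_sum _ H t0 _ _ _ d) => //.
    by move=> t tt; have := sep a t aD tt; rewrite natrM; congr (_ <= dist_int _); ring.
  have -> : (H%:R / (4 * D%:R)) ^+ 2 = H%:R * (H%:R / (16 * D%:R ^+ 2)) :> R.
    by field; rewrite gt_eqF.
  by rewrite ler_pM2l // ler_pdivlMr ?mulr_gt0 ?exprn_gt0 // mulrC.
have lower : 3 / 4 * (D%:R * H%:R) <= E.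
  rewrite /E exchange_big /=; under eq_bigr do rewrite exchange_big /=.
  have pair j k : (j < D)%N -> (k < D)%N -> (j == k)%:R * H%:R - H%:R / (4 * D%:R) <=
      \sum_(i < H) cos (j%:R * tau i - k%:R * tau i).
    move=> jD kD.
    have HD0 : 0 <= H%:R / (4 * D%:R) :> R by rewrite divr_ge0 // mulr_ge0 // ltW.
    case: (ltngtP j k) => jk.
    - have /freq : (0 < k - j < D)%N by lia.
      rewrite ler_norml mul0r sub0r => /andP[+ _]; congr (_ <= _).
      by apply: eq_bigr => i _; rewrite natrB 1?ltnW // -cosN; congr cos; ring.
    - have /freq : (0 < j - k < D)%N by lia.
      rewrite ler_norml mul0r sub0r => /andP[+ _]; congr (_ <= _).
      by apply: eq_bigr => i _; rewrite natrB 1?ltnW //; congr cos; ring.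
    rewrite jk mul1r; under eq_bigr do rewrite subrr cos0.
    by rewrite sumr_const card_ord lerBlDr lerDl.
  apply: le_trans (_ : \sum_(j < D) \sum_(k < D)
      ((j == k :> nat)%:R * H%:R - H%:R / (4 * D%:R)) <= _).
    have row (j : 'I_D) : \sum_(k < D) ((j == k :> nat)%:R * H%:R - H%:R / (4 * D%:R))
        = 3 / 4 * H%:R :> R.
      rewrite sumrB sumr_const card_ord (bigD1 j) //= eqxx big1 => [|k kj].
        by rewrite mul1r addr0 -[_ *+ D]mulr_natr; field; rewrite gt_eqF.
      by rewrite -val_eqE eq_sym in kj; rewrite (negbTE kj) mul0r.
    under eq_bigr do rewrite row.
    by rewrite sumr_const card_ord -[leRHS]mulr_natl [leRHS]mulrCA.
  by apply: ler_sum => j _; apply: ler_sum => k _; by apply: pair.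
have : 3 / 4 * (D%:R * H%:R) * w ^+ 2 <= 2 * H%:R.
  by apply: le_trans upper; rewrite ler_wpM2r ?sqr_ge0.
nra.
Qed.

Lemma exists_nat_ge (R : realType) (x : R) : exists2 n : nat, (0 < n)%N & x <= n%:R.
Proof.
exists (Num.truncn `|x|).+1 => //; apply: le_trans (ler_norm x) _.
by have /andP[_ /ltW] := truncn_itv (normr_ge0 x).
Qed.

Lemma int_cases (R : realType) (k : int) :
  [\/ k%:~R <= -1 :> R, k = 0 | 1 <= k%:~R :> R].
Proof.
have [k0|k0|->] := ltgtP k 0.
- by apply: Or31; rewrite -[-1]/((-1)%:~R) ler_int; lia.
- by apply: Or33; rewrite -[1]/(1%:~R) ler_int; lia.
- exact: Or32.
Qed.

(** Density of [q ^+ 2 * a0 * i ^+ 2 + be * i + ga] at scale [1 / P] within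
    [P ^+ 32] terms, uniformly in the lower coefficients. The crude
    Diophantine exponent [2] suffices: a kernel of order [D ~ P ^+ 2] resolves
    the scale [1 / P], blocks of length [t0 = P ^+ 5] make the bad differences
    rarer than [1 / D ^+ 2], and then only multiples of [a0] of size
    [T ~ P ^+ 7] occur, whose distance to the integers is at least
    [c / T ^+ 2 ~ P ^- 14]; all losses are absorbed by [H >= kappa * P ^+ 32]. *)
Lemma roth_quadratic_hits (R : realType) (a0 c kappa c1 : R) (Q : nat) :
  0 < c -> 0 < kappa -> 0 < c1 ->
  (forall t : nat, (0 < t)%N -> c / t%:R ^+ 2 <= dist_int (a0 * t%:R)) ->
  exists2 P0 : nat, (0 < P0)%N & forall P H q : nat, (P0 <= P)%N ->
    kappa * P%:R ^+ 32 <= H%:R -> (0 < q <= Q)%N ->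
    forall be ga u w : R, c1 / P%:R <= w ->
    exists2 i, (i < H)%N &
      dist_int (q%:R ^+ 2 * a0 * i%:R ^+ 2 + be * i%:R + ga - u) < w.
Proof.
move=> c0 kappa0 c10 roth.
have [K K0 K8] := exists_nat_ge (8 / c1 ^+ 2).
pose N : R := 16 * K%:R ^+ 2 * (3 + 16 * K%:R ^+ 2 * Q%:R ^+ 4 / c).
have NE : N = 16 * K%:R ^+ 2 * (3 + 16 * K%:R ^+ 2 * Q%:R ^+ 4 / c) by [].
have N0 : 0 <= N by rewrite /N; do !(apply: mulr_ge0 || apply: addr_ge0 || apply: exprn_ge0) => //; rewrite invr_ge0 ltW.
clearbody N.
have [P0 P00 HP0] := exists_nat_ge (64 * K%:R ^+ 2 + 2 * N / kappa).
exists P0 => // P H q P0P HP /andP[q0 qQ] be ga u w cw.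
have P_gt0 : (0 < P)%N by exact: leq_trans P0P.
have Q_gt0 : (0 < Q)%N by exact: leq_trans qQ.
have X1 : 1 <= P%:R :> R by rewrite ler1n.
have X0 : 0 < P%:R :> R by rewrite ltr0n.
have K1 : 0 < K%:R :> R by rewrite ltr0n.
have Q1 : 0 < Q%:R :> R by rewrite ltr0n.
have PX : P0%:R <= P%:R :> R by rewrite ler_nat.
have KX : 64 * K%:R ^+ 2 <= P%:R :> R.
  apply: le_trans PX; apply: le_trans HP0; rewrite lerDl.
  by rewrite divr_ge0 ?mulr_ge0 // ltW.
have NX : 2 * N <= kappa * P%:R.
  rewrite [leRHS]mulrC -ler_pdivrMr //; apply: le_trans PX; apply: le_trans HP0.
  by rewrite lerDr mulr_ge0 // exprn_ge0.
have H_gt0 : 0 < H%:R :> R by apply: lt_le_trans HP; rewrite mulr_gt0 ?exprn_gt0.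
pose T : R := 2 * K%:R * Q%:R ^+ 2 * P%:R ^+ 7.
have T0 : 0 < T by rewrite /T !mulr_gt0 ?exprn_gt0.
apply: (@quadratic_hits _ (K * P ^ 2) H (P ^ 5) _ _ _ _ _ (c / (2 * T ^+ 2))).
- by apply: le_trans cw; rewrite divr_ge0 // ltW.
- apply: le_trans (_ : (K * P ^ 2)%:R * (c1 / P%:R) ^+ 2 <= _).
    have -> : (K * P ^ 2)%:R * (c1 / P%:R) ^+ 2 = K%:R * c1 ^+ 2 :> R.
      by rewrite natrM natrX; field; rewrite gt_eqF.
    by rewrite -ler_pdivrMr // exprn_gt0.
  by rewrite ler_wpM2l // ler_pXn2r ?nnegrE ?divr_ge0 ?(ltW c10) // (le_trans _ cw) // divr_ge0 // ltW.
- by rewrite divr_gt0 // mulr_gt0 // exprn_gt0.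
- by rewrite expn_gt0 P_gt0.
- by rewrite -(ltr0n R).
- move=> a t /andP[a0' aD] /andP[t0 tP].
  pose s := (2 * q ^ 2 * (a * t))%N.
  have s0 : (0 < s)%N by rewrite /s !muln_gt0 ?expn_gt0 q0 a0' t0.
  have -> : 2 * (q%:R ^+ 2 * a0) * (a * t)%:R = a0 * s%:R.
    by rewrite /s !natrM ?natrX; ring.
  apply: le_trans (roth s s0).
  have -> : 2 * (c / (2 * T ^+ 2)) = c / T ^+ 2 by field; rewrite gt_eqF.
  rewrite ler_pM2l // lef_pV2 ?posrE ?exprn_gt0 ?ltr0n //.
  rewrite ler_pXn2r ?nnegrE ?ler0n ?(ltW T0) //.
  have -> : T = (2 * Q ^ 2 * (K * P ^ 2 * P ^ 5))%:R.
    by rewrite /T !natrM ?natrX; ring.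
  rewrite ler_nat; apply: leq_mul; first by rewrite leq_pmul2l // leq_exp2r.
  by apply: leq_mul; exact: ltnW.
have -> : 2 / (c / (2 * T ^+ 2)) = 16 * K%:R ^+ 2 * Q%:R ^+ 4 / c * P%:R ^+ 14.
  by rewrite /T; field; rewrite !gt_eqF.
rewrite natrM !natrX.
set X : R := P%:R in X1 X0 PX KX NX HP T T0 *; set k : R := K%:R in K1 KX NE *.
have pow m n : (m <= n)%N -> X ^+ m <= X ^+ n by move=> mn; exact: ler_weXn2l.
have -> : 16 * (k * X ^+ 2) ^+ 2 * (3 + 2 * (H%:R / X ^+ 5)
      + 16 * k ^+ 2 * Q%:R ^+ 4 / c * X ^+ 14)
    = 32 * k ^+ 2 / X * H%:R + (48 * k ^+ 2 * X ^+ 4 + (N - 48 * k ^+ 2) * X ^+ 18).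
  by rewrite NE; field; rewrite !gt_eqF.
have half1 : 32 * k ^+ 2 / X * H%:R <= 1 / 2 * H%:R.
  by rewrite ler_wpM2r ?ler0n // ler_pdivrMr //; lra.
have half2 : 48 * k ^+ 2 * X ^+ 4 <= 48 * k ^+ 2 * X ^+ 18.
  by rewrite ler_wpM2l ?mulr_ge0 ?exprn_ge0 ?(ltW K1) // pow.
have half3 : 2 * N * X ^+ 18 <= H%:R.
  apply: le_trans HP; apply: le_trans (_ : kappa * X * X ^+ 18 <= _).
    by rewrite ler_wpM2r // exprn_ge0 // ltW.
  by rewrite -mulrA -exprS ler_wpM2l ?(ltW kappa0) // pow.
lra.
Qed.

(** * Affine displacements *)

(** Displacements confined to [-L, L] modulo 1 and moving by less than the
    forbidden gap [1 - 2 * L] at each step cannot cross the gap, hence are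
    confined as real numbers. *)
Lemma no_jump (R : realType) (L x psi : R) (M : nat) :
  `|psi| < 1 - 2 * L -> `|x| <= L ->
  (forall j, (j <= M)%N -> exists z : int, `|x + j%:R * psi - z%:~R| <= L) ->
  forall j, (j <= M)%N -> `|x + j%:R * psi| <= L.
Proof.
rewrite ltr_norml => psiL xL near; elim=> [_|j IHj jM]; first by rewrite mul0r addr0.
have := IHj (ltnW jM); have [z] := near _ jM; rewrite -natr1 !ler_norml.
by case: (int_cases R z) => [z1|->|z1]; lra.
Qed.

(** On [0, 4 H] an affine function moves away from its value at the midpoint
    [2 H], which has some sign: one of the two outer quarters works. *)
Lemma linear_quarter (R : realType) (x psi : R) (H : nat) :
  exists2 j0 : nat, (j0 <= 3 * H)%N &
    (forall i, (i < H)%N -> H%:R * `|psi| <= x + (j0 + i)%:R * psi) \/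
    (forall i, (i < H)%N -> x + (j0 + i)%:R * psi <= - (H%:R * `|psi|)).
Proof.
have iH i : (i < H)%N -> 0 <= i%:R * `|psi| /\ i%:R * `|psi| <= H%:R * `|psi|.
  move=> iH; split; first exact: mulr_ge0.
  by rewrite ler_wpM2r // ler_nat ltnW.
move: iH; case: (ger0P psi) => psi0 iH;
  have [x0|x0] := lerP 0 (x + 2 * H%:R * psi).
- exists (3 * H)%N => //; left=> i /iH ii; rewrite natrD natrM; lra.
- exists 0%N => //; right=> i /iH ii; rewrite add0n; lra.
- exists 0%N => //; left=> i /iH ii; rewrite add0n; lra.
- exists (3 * H)%N => //; right=> i /iH ii; rewrite natrD natrM; lra.
Qed.

(** Dirichlet's approximation theorem, by the pigeonhole principle on the
    fractional parts of [i * phi], [i <= Q]. *)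
Lemma dirichlet (R : realType) (phi : R) (Q : nat) : (0 < Q)%N ->
  exists q : nat, exists2 z : int, (0 < q <= Q)%N & `|q%:R * phi - z%:~R| < Q%:R^-1.
Proof.
move=> Q0; have QR0 : 0 < Q%:R :> R by rewrite ltr0n.
pose fr (i : nat) : R := i%:R * phi - (Num.floor (i%:R * phi))%:~R.
have fr01 i : 0 <= fr i < 1.
  have := floor_itv (i%:R * phi); rewrite /fr intrD1; lra.
pose bin (i : nat) := Num.truncn (Q%:R * fr i).
have binP i : (bin i)%:R <= Q%:R * fr i < (bin i)%:R + 1.
  rewrite natr1; apply: truncn_itv; rewrite mulr_ge0 // ; by case/andP: (fr01 i).
have binQ i : (bin i < Q)%N.
  rewrite -(ltr_nat R); apply: le_lt_trans (_ : _ <= Q%:R * fr i) _; first by case/andP: (binP i).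
  by rewrite gtr_pMr //; case/andP: (fr01 i).
have [i [j [ij jQ bij]]] : exists i j, [/\ (i < j)%N, (j <= Q)%N & bin i = bin j].
  apply: contrapT => none.
  suff : (Q.+1 <= Q)%N by rewrite ltnn.
  apply: (@pigeonhole _ _ bin); last by move=> _ [i _ <-] /=.
  move=> i j /set_mem /= iQ /set_mem /= jQ bij.
  have [ij|ij|//] := ltngtP i j; exfalso; apply: none.
    by exists i, j.
  by exists j, i.
exists (j - i)%N, (Num.floor (j%:R * phi) - Num.floor (i%:R * phi)); first by lia.
have -> : (j - i)%:R * phi - (Num.floor (j%:R * phi) - Num.floor (i%:R * phi))%:~R
    = fr j - fr i by rewrite natrB 1?ltnW // intrB /fr; ring.
rewrite -[_^-1]mul1r ltr_pdivlMr // -[X in _ * X](gtr0_norm QR0) -normrM.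
have := binP i; have := binP j; rewrite bij ltr_norml; lra.
Qed.

(** * Repetitions force the sequence out of an arc *)

(** The next two lemmas are where arcs shorter than a half-circle matter: a
    displacement by less than a half past one end of such an arc cannot come
    back into it through the other end. *)
Lemma escape_right (R : realType) (a b L s x s' : R) (z z' : int) :
  b - a <= L -> L < 2^-1 -> x <= L -> s' = s + x + z%:~R ->
  s < b -> b < s + x -> a <= s' - z'%:~R <= b -> False.
Proof.
move=> baL L2 xL -> sb bsx; have := int_cases R (z - z').
have -> : s + x + z%:~R - z'%:~R = s + x + (z - z')%:~R by rewrite intrB; ring.
by case=> [z1|->|z1]; lra.
Qed.

Lemma escape_left (R : realType) (a b L s x s' : R) (z z' : int) :
  b - a <= L -> L < 2^-1 -> - L <= x -> s' = s + x + z%:~R ->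
  a < s -> s + x < a -> a <= s' - z'%:~R <= b -> False.
Proof.
move=> baL L2 xL -> sb bsx; have := int_cases R (z - z').
have -> : s + x + z%:~R - z'%:~R = s + x + (z - z')%:~R by rewrite intrB; ring.
by case=> [z1|->|z1]; lra.
Qed.

(** The contradiction at the heart of the theorem, free of asymptotics. The
    displacements [S (k + n) - S k] are affine in [k] with slope [2 a0 n];
    along the progression of step [q] they reduce to an affine sequence of
    slope [psi], which never jumps and on a quarter of the range keeps its sign
    and a size of at least [2 w]. On that quarter [S] comes within [2 w] of the
    end of the arc towards which the displacement points, and so gets pushed
    out of the arc. *)
Lemma displacement_escape (R : realType) (a0 b0 g0 L a b w : R) (S : nat -> R)
    (n m H q : nat) (z : int) :
  let psi := q%:R * (2 * a0 * n%:R) - z%:~R in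
  (forall k, S k = a0 * k%:R ^+ 2 + b0 * k%:R + g0) ->
  b - a <= L -> L < 2^-1 -> `|psi| < 1 - 2 * L ->
  (1 + q * (4 * H) <= m)%N ->
  0 < w -> 2 * w <= b - a -> 2 * w <= H%:R * `|psi| ->
  (forall be ga u : R, exists2 i, (i < H)%N &
      dist_int (q%:R ^+ 2 * a0 * i%:R ^+ 2 + be * i%:R + ga - u) < w) ->
  (forall k, (1 <= k <= m)%N ->
     exists z : int, `|S (k + n)%N - S k - z%:~R| <= L) ->
  (forall k (z : int), (1 <= k <= m)%N -> a < S k - z%:~R < b ->
     exists z' : int, a <= S (k + n)%N - z'%:~R <= b) ->
  False.
Proof.
move=> psi SE baL L2 psiL Hm w0 wba wpsi hits close stay.
have m_gt0 : (0 < m)%N by apply: leq_trans Hm; exact: leq_addr.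
have km j : (j <= 4 * H)%N -> (1 <= 1 + q * j <= m)%N.
  move=> jH; rewrite leq_addr /=; apply: leq_trans Hm.
  by rewrite leq_add2l leq_mul.
have [|z0 xL] := close 1%N; first by rewrite m_gt0.
set x := _ - z0%:~R in xL.
have step j : S (1 + q * j + n)%N - S (1 + q * j)%N
    = x + j%:R * psi + (z0 + j%:Z * z)%:~R.
  by rewrite /x /psi !SE !(natrD, natrM) intrD intrM; ring.
have stayL j : (j <= 4 * H)%N -> `|x + j%:R * psi| <= L.
  apply: no_jump => // {}j jH; have [z1] := close _ (km j jH).
  rewrite step => h; exists (z1 - (z0 + j%:Z * z)).
  by rewrite intrB; move: h; congr (`|_| <= _); ring.
have [j0 j0H side] := linear_quarter x psi H.
have hit u : exists j (z1 : int), [/\ (j < 4 * H)%N, (j0 <= j < j0 + H)%N &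
    `|S (1 + q * j)%N - z1%:~R - u| < w].
  have [i iH] := hits (2 * a0 * (1 + q * j0)%:R * q%:R + b0 * q%:R)
    (S (1 + q * j0)%N) u.
  move=> /dist_int_lt[z1 h]; exists (j0 + i)%N, z1; split; [clear -iH j0H; lia|clear -iH; lia|].
  move: h; congr (`|_| < _); rewrite !SE !(natrD, natrM); ring.
case: side => side.
- have [j [z1 [jH /andP[j0j jj0] /[!ltr_norml] Sz]]] := hit (b - w).
  have jle := ltnW jH; have := stayL j jle.
  have := side (j - j0)%N ltac:(clear -j0j jj0; lia); rewrite subnKC // ler_norml => xw /andP[_ xL'].
  have Sab : a < S (1 + q * j)%N - z1%:~R < b by clear -Sz w0 wba; lra.
  have [z2 Sab'] := stay _ z1 (km j jle) Sab.
  apply: (@escape_right R a b L (S (1 + q * j)%N - z1%:~R) (x + j%:R * psi)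
    (S (1 + q * j + n)%N) (z1 + (z0 + j%:Z * z)) z2 baL L2 xL' _ _ _ Sab').
  + rewrite -[LHS](subrK (S (1 + q * j)%N)) step intrD; ring.
  + by case/andP: Sab.
  + clear -Sz xw wpsi; lra.
- have [j [z1 [jH /andP[j0j jj0] /[!ltr_norml] Sz]]] := hit (a + w).
  have jle := ltnW jH; have := stayL j jle.
  have := side (j - j0)%N ltac:(clear -j0j jj0; lia); rewrite subnKC // ler_norml => xw /andP[xL' _].
  have Sab : a < S (1 + q * j)%N - z1%:~R < b by clear -Sz w0 wba; lra.
  have [z2 Sab'] := stay _ z1 (km j jle) Sab.
  apply: (@escape_left R a b L (S (1 + q * j)%N - z1%:~R) (x + j%:R * psi)
    (S (1 + q * j + n)%N) (z1 + (z0 + j%:Z * z)) z2 baL L2 xL' _ _ _ Sab').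
  + rewrite -[LHS](subrK (S (1 + q * j)%N)) step intrD; ring.
  + by case/andP: Sab.
  + clear -Sz xw wpsi; lra.
Qed.

(** With the exponent [1/32], powers of [n] become integer powers of the
    natural number [P], which is the scale used in [roth_quadratic_hits]. *)
Lemma powR_root_bounds (R : realType) (n : nat) : (0 < n)%N ->
  exists2 P : nat, (P%:R : R) ^+ 32 <= n%:R & n%:R `^ 32^-1 <= 2 * P%:R :> R.
Proof.
move=> n0; pose p : R := n%:R `^ 32^-1.
have one : (1 : R) `^ 32^-1 = 1 by rewrite powR1.
have p1 : 1 <= p by rewrite /p -[leLHS]one ge0_ler_powR ?nnegrE ?ler1n.
exists (Num.truncn p); have /andP[Pp pP] := truncn_itv (le_trans ler01 p1).
  have -> : n%:R = p ^+ 32.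
    by rewrite -powR_mulrn ?powR_ge0 // -powRrM mulVf // powRr1.
  by rewrite ler_pXn2r ?nnegrE ?powR_ge0.
have P1 : 1 <= (Num.truncn p)%:R :> R.
  rewrite ler1n lt0n; apply/eqP => P0; move: pP; rewrite P0; lra.
by move: pP; rewrite -natr1 -/p; lra.
Qed.

(** The Diophantine condition at [2 * n * q] with [q] bounded: since
    [(2 * n * q) `^ 32^-1] is of order [P], the loss compared with [1 / n] is
    only a factor [P]. *)
Lemma roth_slope_bound (R : realType) (a0 c : R) (n q Q P : nat) :
  0 < c ->
  (forall t : nat, (0 < t)%N ->
     c / (t%:R `^ (1 + 32^-1)) <= dist_int (a0 * t%:R)) ->
  (0 < n)%N -> (0 < P)%N -> (0 < q <= Q)%N -> n%:R `^ 32^-1 <= 2 * P%:R :> R ->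
  c / (8 * Q%:R ^+ 2 * n%:R * P%:R) <= dist_int (q%:R * (2 * a0 * n%:R)).
Proof.
move=> c0 roth n_gt0 P_gt0 /andP[q0 qQ] nP.
have Q_gt0 : (0 < Q)%N by exact: leq_trans qQ.
have -> : q%:R * (2 * a0 * n%:R) = a0 * (2 * n * q)%:R by rewrite !natrM; ring.
apply: le_trans (roth _ _); last by rewrite !muln_gt0 n_gt0.
have root : (2 * n * q)%:R `^ 32^-1 <= 2 * Q%:R * (2 * P%:R) :> R.
  rewrite -mulnA mulnCA natrM powRM // mulrC; apply: ler_pM => //; try exact: powR_ge0.
  apply: le_trans (_ : (2 * q)%:R `^ 1 <= _).
    by rewrite ler_powR ?ler1n ?muln_gt0 //; lra.
  by rewrite powRr1 // natrM ler_pM2l // ler_nat.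
rewrite ler_pM2l // lef_pV2 ?posrE ?powR_gt0 ?ltr0n ?muln_gt0 ?n_gt0 //; last first.
  by rewrite !mulr_gt0 // ltr0n.
rewrite powRD; last by rewrite pnatr_eq0 -lt0n !muln_gt0 n_gt0 q0 implybT.
rewrite powRr1 //.
have -> : 8 * Q%:R ^+ 2 * n%:R * P%:R = 2 * n%:R * Q%:R * (2 * Q%:R * (2 * P%:R)) :> R by ring.
apply: ler_pM => //.
by rewrite !natrM ler_wpM2l ?mulr_ge0 // ler_nat.
Qed.

Lemma quarter_length (R : realType) (eta : R) (n m Q : nat) :
  0 < eta -> (0 < Q)%N -> (0 < n)%N ->
  16 * Q%:R <= eta * n%:R -> eta * n%:R <= m%:R ->
  exists2 H : nat, (1 + Q * (4 * H) <= m)%N & eta / (8 * Q%:R) * n%:R <= H%:R.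
Proof.
move=> eta0 Q0 n0 eta16 etam; have QR0 : 0 < Q%:R :> R by rewrite ltr0n.
have m_gt0 : (0 < m)%N.
  by rewrite -(ltr_nat R); apply: lt_le_trans etam; rewrite mulr_gt0 // ltr0n.
exists ((m - 1) %/ (4 * Q))%N.
  have := leq_trunc_div (m - 1) (4 * Q); set H := (_ %/ _)%N.
  have -> : (Q * (4 * H) = H * (4 * Q))%N by rewrite mulnCA [RHS]mulnCA [(Q * H)%N]mulnC.
  by rewrite add1n -[X in (_ < X)%N]prednK // ltnS -subn1.
have : (m <= ((m - 1) %/ (4 * Q)).+1 * (4 * Q))%N.
  have : (m - 1 < ((m - 1) %/ (4 * Q)).+1 * (4 * Q))%N by rewrite ltn_ceil // muln_gt0.
  by rewrite -ltnS subn1 prednK.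
set H := (_ %/ _)%N; rewrite -(ler_nat R) natrM -natr1 natrM => mH.
set t := eta / (8 * Q%:R) * n%:R.
have etaE : eta * n%:R = 8 * Q%:R * t by rewrite /t; field; rewrite gt_eqF.
rewrite etaE in etam eta16.
have t2 : 2 <= t by rewrite -(ler_pM2l (mulr_gt0 (ltr0n R 8) QR0)); lra.
have : 2 * t <= H%:R + 1 by rewrite -(ler_pM2l (mulr_gt0 (ltr0n R 4) QR0)); lra.
lra.
Qed.

(** The choice of scales. [Q] makes Dirichlet's approximation finer than the
    gap [1 - 2 L]; the range has [H] of order [n]; the slope is at least
    [1 / (n P)] up to constants, so that the displacement reaches the order
    [1 / P] of the radius at which the quadratic sequence is dense. *)
Lemma short_repetitions (R : realType) (a0 b0 g0 c L a b eta : R) (S : nat -> R) :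
  (forall k, S k = a0 * k%:R ^+ 2 + b0 * k%:R + g0) ->
  0 < c ->
  (forall t : nat, (0 < t)%N ->
     c / (t%:R `^ (1 + 32^-1)) <= dist_int (a0 * t%:R)) ->
  a < b -> b - a <= L -> L < 2^-1 -> 0 < eta ->
  exists n0 : nat, forall n m : nat, (n0 <= n)%N ->
    (forall k, (1 <= k <= m)%N ->
       exists z : int, `|S (k + n)%N - S k - z%:~R| <= L) ->
    (forall k (z : int), (1 <= k <= m)%N -> a < S k - z%:~R < b ->
       exists z' : int, a <= S (k + n)%N - z'%:~R <= b) ->
    m%:R < eta * n%:R.
Proof.
move=> SE c_gt0 roth ab baL L2 eta0.
have [Q Q0 Qgap] := exists_nat_ge (2 / (1 - 2 * L)).
have QR0 : 0 < Q%:R :> R by rewrite ltr0n.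
have Qinv : Q%:R^-1 < 1 - 2 * L.
  rewrite -[_^-1]mul1r ltr_pdivrMr; last by lra.
  by move: Qgap; rewrite ler_pdivrMr; lra.
pose kappa := eta / (8 * Q%:R).
have kappa0 : 0 < kappa by rewrite /kappa divr_gt0 // mulr_gt0.
pose rho := kappa * c / (8 * Q%:R ^+ 2).
have rho0 : 0 < rho by rewrite /rho !(divr_gt0, mulr_gt0).
pose c1 := Num.min rho (b - a) / 2.
have c10 : 0 < c1 by rewrite /c1 divr_gt0 // lt_min rho0 subr_gt0.
have c1rho : 2 * c1 <= rho by rewrite /c1 mulrC divfK // ge_min lexx.
have c1ba : 2 * c1 <= b - a by rewrite /c1 mulrC divfK // ge_min lexx orbT.
have [|P0 P00 hits] := @roth_quadratic_hits R a0 c kappa c1 Q c_gt0 kappa0 c10.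
  move=> t t0; apply: le_trans (roth t t0).
  have tR : 1 <= t%:R :> R by rewrite ler1n.
  rewrite ler_pM2l // lef_pV2 ?posrE ?powR_gt0 ?exprn_gt0 ?ltr0n //.
  by rewrite -powR_mulrn ?ler0n // ler_powR //; lra.
have [n1 n10 Hn1] := exists_nat_ge (16 * Q%:R / eta).
(* [B] hides a power too large to be evaluated as a natural number. *)
have [B BE] : exists B, B = ((2 * P0) ^ 32)%N by eexists.
exists (B + n1)%N => n m n0n close stay.
rewrite ltNge; apply/negP => etam.
have Bn : ((2 * P0)%:R : R) ^+ 32 <= n%:R.
  by rewrite -natrX -BE ler_nat; apply: leq_trans n0n; exact: leq_addr.
have n1n : (n1 <= n)%N by apply: leq_trans n0n; exact: leq_addl.
clear B BE n0n; have n_gt0 : (0 < n)%N by exact: leq_trans n1n.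
have nR : 0 < n%:R :> R by rewrite ltr0n.
have [P Pn nP] := powR_root_bounds R n_gt0.
have P0P : (P0 <= P)%N.
  rewrite -(ler_nat R) -(ler_pM2l (ltr0n R 2)); apply: le_trans nP.
  have -> : 2 * P0%:R = ((2 * P0)%:R ^+ 32) `^ 32^-1 :> R.
    by rewrite -powR_mulrn // -powRrM mulfV // powRr1 // natrM.
  by rewrite ge0_ler_powR ?nnegrE.
have P_gt0 : (0 < P)%N by exact: leq_trans P0P.
have PR0 : 0 < P%:R :> R by rewrite ltr0n.
have eta16 : 16 * Q%:R <= eta * n%:R.
  by rewrite -ler_pdivrMl // mulrC; apply: le_trans Hn1 _; rewrite ler_nat.
have [H Hm kH] := quarter_length eta0 Q0 n_gt0 eta16 etam.
have kPH : kappa * P%:R ^+ 32 <= H%:R.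
  by apply: le_trans kH; rewrite ler_wpM2l // ltW.
have [q [z qQ qz]] := dirichlet (2 * a0 * n%:R) Q0.
have slope := le_trans (roth_slope_bound c_gt0 roth n_gt0 P_gt0 qQ nP) (dist_int_le _ z).
apply: (@displacement_escape R a0 b0 g0 L a b (c1 / P%:R) S n m H q z) => //.
- exact: lt_trans Qinv.
- apply: leq_trans Hm; rewrite leq_add2l leq_mul //; by case/andP: qQ.
- by rewrite divr_gt0.
- apply: le_trans c1ba; rewrite ler_pM2l // ler_pdivrMr //.
  by rewrite ler_peMr ?(ltW c10) // ler1n.
- apply: le_trans (_ : kappa * n%:R * (c / (8 * Q%:R ^+ 2 * n%:R * P%:R)) <= _).
    have -> : kappa * n%:R * (c / (8 * Q%:R ^+ 2 * n%:R * P%:R)) = rho / P%:R.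
      by rewrite /rho; field; rewrite !gt_eqF.
    by rewrite mulrA ler_pM2r // invr_gt0.
  apply: ler_pM => //; first by rewrite mulr_ge0 // ltW.
  by rewrite divr_ge0 ?(ltW c_gt0) // !mulr_ge0.
- by move=> be ga u; apply: (hits P H q P0P kPH qQ); exact: lexx.
Qed.

(** * Arcs of the circle *)

Lemma circle_eq_lift (R : realType) (x y : R) :
  \pi_(circle R) x = \pi_(circle R) y -> exists z : int, x = y + z%:~R.
Proof.
move=> /eqP; rewrite -Quotient.idealrBE => /intrP[z xy]; exists z.
by rewrite -xy addrC subrK.
Qed.

Lemma circle_addz (R : realType) (x : R) (z : int) :
  \pi_(circle R) (x + z%:~R) = \pi_(circle R) x.
Proof.
apply/eqP; rewrite -Quotient.idealrBE addrAC subrr add0r.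
by apply/intrP; exists z.
Qed.

Lemma circle_mulrz (R : realType) (x : R) (z : int) :
  \pi_(circle R) x *~ z = \pi_(circle R) (x * z%:~R).
Proof. by rewrite mulrzr raddfMz. Qed.

Lemma interval_closedW (R : realType) (a b x : R) (ba bb : bool) :
  x \in Interval (BSide ba a) (BSide bb b) -> a <= x <= b.
Proof.
by rewrite itv_boundlr => /andP[]; case: ba; case: bb; rewrite !bnd_simp => ax xb;
  rewrite ?(ltW ax) ?(ltW xb) ?ax ?xb.
Qed.

Lemma interval_openW (R : realType) (a b x : R) (ba bb : bool) :
  a < x < b -> x \in Interval (BSide ba a) (BSide bb b).
Proof.
rewrite itv_boundlr => /andP[ax xb].
by case: ba; case: bb; rewrite !bnd_simp ?ax ?xb ?(ltW ax) ?(ltW xb).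
Qed.

Lemma circle_arc_diff (R : realType) (A : set (circle R)) (len x y : R) :
  circle_arc A len -> A (\pi_(circle R) x) -> A (\pi_(circle R) y) ->
  exists z : int, `|y - x - z%:~R| <= len.
Proof.
case=> a [b] [ba] [bb] [ab -> _ ->].
move=> [x' /= /interval_closedW x'ab /circle_eq_lift[zx xE]].
move=> [y' /= /interval_closedW y'ab /circle_eq_lift[zy yE]].
by exists (zx - zy); rewrite intrB ler_norml; lra.
Qed.

Lemma quad_coding_same_cell (R : realType) (K : numFieldType) (N : nat)
    (J : 'I_N -> set (circle R)) (lam : 'I_N -> K)
    (alpha beta gamma : circle R) (n n' : int) (l : 'I_N) :
  partition [set: 'I_N] J [set: circle R] -> injective lam ->
  quad_coding lam J alpha beta gamma n = quad_coding lam J alpha beta gamma n' ->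
  J l (alpha *~ (n ^+ 2) + beta *~ n + gamma) ->
  J l (alpha *~ (n' ^+ 2) + beta *~ n' + gamma).
Proof.
move=> [cov triv _] lam_inj; rewrite /quad_coding.
set x := _ + gamma; set x' := _ + gamma.
have value y k : J k y -> \sum_(i < N) lam i * \1_(J i) y = lam k.
  move=> Jky; rewrite (bigD1 k) //= big1 => [|i ik].
    by rewrite indicE mem_set // mulr1 addr0.
  rewrite indicE memNset ?mulr0 // => Jiy.
  by move/eqP: ik; apply; apply: triv => //; exists y.
have [k _ Jk] : cover [set: 'I_N] J x' by rewrite cov.
by move=> e Jl; rewrite (value _ _ Jl) (value _ _ Jk) in e; rewrite (lam_inj _ _ e).
Qed.

(** Finitely many single points cannot cover the circle: among [N + 1] equally
    spaced points two share an arc. *)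
Lemma exists_nondegenerate_arc (R : realType) (N : nat)
    (J : 'I_N -> set (circle R)) (len : 'I_N -> R) :
  cover [set: 'I_N] J = [set: circle R] ->
  (forall l, circle_arc (J l) (len l)) -> exists l, 0 < len l.
Proof.
move=> cov arcs; pose pt (i : 'I_N.+1) : R := i%:R / N.+1%:R.
have [|f Jf] := @choice _ _ (fun i l => J l (\pi_(circle R) (pt i))).
  move=> i; have [l _ Jl] : cover [set: 'I_N] J (\pi_(circle R) (pt i)) by rewrite cov.
  by exists l.
have [i [j [ij fij]]] : exists i j, i != j /\ f i = f j.
  apply: contrapT => none; suff : (N.+1 <= N)%N by rewrite ltnn.
  have finj : injective f.
    move=> i j fij; apply/eqP; apply/negPn/negP => ij; apply: none; by exists i, j.
  by have := leq_card f finj; rewrite !card_ord.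
exists (f i); rewrite ltNge; apply/negP => len0.
have Jj : J (f i) (\pi_(circle R) (pt j)) by rewrite fij.
have [z zlen] := circle_arc_diff (arcs (f i)) (Jf i) Jj.
have diff : pt j - pt i - z%:~R = 0 by apply/eqP; rewrite -normr_le0 (le_trans zlen).
have pt01 k : 0 <= pt k < 1.
  by rewrite /pt divr_ge0 //= ltr_pdivrMr ?ltr0n // mul1r ltr_nat.
have [z1|z0|z1] := int_cases R z; have := pt01 i; have := pt01 j; try lra.
move: diff; rewrite z0 subr0 -mulrBl => /eqP; rewrite mulf_eq0 invr_eq0 pnatr_eq0 orbF.
by rewrite subr_eq0 eqr_nat => /eqP /val_inj ji; rewrite ji eqxx in ij.
Qed.

(** * From lengths of repetitions to the limits superior *)

Lemma limn_esup_eq1 (R : realType) (u : (\bar R)^nat) :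
  (forall n, 1 <= u n)%E ->
  (forall e : R, 0 < e -> exists n0 : nat, forall n : nat, (n0 <= n)%N -> (u n <= 1 + e%:E)%E) ->
  limn_esup u = 1%E.
Proof.
move=> u1 ue; apply/eqP; rewrite eq_le; apply/andP; split.
  apply/lee_addgt0Pr => e /ue[n0 hn0].
  apply: le_trans (_ : ereal_sup [set u x | x in [set n | (n0 <= n)%N]] <= _)%E.
    apply: ereal_inf_lbound; exists [set n | (n0 <= n)%N] => //.
    exact: nbhs_infty_ge.
  by apply: ge_ereal_sup => _ [n /= /hn0 h <-].
apply: le_ereal_inf_tmp => _ [V [n0 _ n0V] <-].
apply: le_trans (u1 n0) _; apply: ereal_sup_ubound; exists n0 => //.
by apply: n0V => /=.
Qed.

Lemma sup_nat_ge0 (R : realType) (S : set nat) : (0 <= sup_nat R S)%E.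
Proof. by apply: ereal_sup_ubound; left. Qed.

Lemma sup_nat_le (R : realType) (S : set nat) (x : R) : 0 <= x ->
  (forall m, S m -> m%:R <= x) -> (sup_nat R S <= x%:E)%E.
Proof.
move=> x0 Sx; apply: ge_ereal_sup => _ [->|[m /Sx mx <-]]; by rewrite lee_fin.
Qed.

(** Serves both kinds of repetition: [rep] and [pinned_rep] only differ by the
    family [S]. *)
Lemma sup_growth_eq1 (R : realType) (S : nat -> set nat) :
  (forall eta : R, 0 < eta -> exists n0 : nat, forall n m : nat, (n0 <= n)%N ->
     S n m -> m%:R < eta * n%:R) ->
  limn_esup (fun n => 1 + (n%:R^-1)%:E * sup_nat R (S n))%E = 1%E.
Proof.
move=> small; apply: limn_esup_eq1 => [n|e e0].
  by rewrite leeDl // mule_ge0 ?sup_nat_ge0 // lee_fin invr_ge0.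
have [n0 hn0] := small e e0; exists n0.+1 => n n0n.
have nR : 0 < n%:R :> R by rewrite ltr0n; exact: leq_trans n0n.
rewrite leeD2l // muleC -[e%:E](_ : (e * n%:R)%:E * (n%:R^-1)%:E = _)%E; last first.
  by rewrite -EFinM mulfK // gt_eqF.
apply: lee_wpmul2r; first by rewrite lee_fin invr_ge0 ltW.
apply: sup_nat_le; first by rewrite mulr_ge0 // ltW.
by move=> m Sm; apply: ltW; apply: hn0 Sm; exact: ltnW.
Qed.

(** Lifts everything to the real line, with representatives of [alpha], [beta],
    [gamma], and takes for [a], [b] the ends of an arc of positive length. *)
Lemma quad_coding_short_repetitions (R : realType) (K : numFieldType) (N : nat)
    (J : 'I_N -> set (circle R)) (lam : 'I_N -> K) (alpha beta gamma : circle R) :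
  partition [set: 'I_N] J [set: circle R] ->
  (forall l : 'I_N, exists2 len : R, circle_arc (J l) len & len < 2^-1) ->
  injective lam -> Roth_number alpha ->
  forall eta : R, 0 < eta -> exists n0 : nat, forall n m : nat, (n0 <= n)%N ->
    (forall k : nat, (1 <= k <= m)%N ->
       quad_coding lam J alpha beta gamma k%:Z =
       quad_coding lam J alpha beta gamma (k%:Z + n%:Z)) ->
    m%:R < eta * n%:R.
Proof.
move=> part short lam_inj roth eta eta0.
have [|len lenP] := @choice _ _ (fun l x => circle_arc (J l) x /\ x < 2^-1).
  by move=> l; have [x] := short l; exists x.
have [l0 len0] : exists l, 0 < len l.
  by apply: exists_nondegenerate_arc (fun l => (lenP l).1); case: part.
pose L := \big[Num.max/0]_(l < N) len l.
have lenL l : len l <= L by apply: le_bigmax_cond.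
have L2 : L < 2^-1 by apply: bigmax_lt => [|l _]; [lra|case: (lenP l)].
have [[a [b [ba [bb [ab lenE _ JE]]]]] _] := lenP l0.
rewrite lenE subr_gt0 in len0.
pose S (k : nat) := repr alpha * k%:R ^+ 2 + repr beta * k%:R + repr gamma.
have lift (k : nat) : alpha *~ (k%:Z ^+ 2) + beta *~ k%:Z + gamma = \pi_(circle R) (S k).
  rewrite /S -[alpha in LHS]reprK -[beta in LHS]reprK -[gamma in LHS]reprK.
  rewrite (circle_mulrz _ (k%:Z ^+ 2)) (circle_mulrz _ k%:Z) rmorphXn.
  by rewrite !raddfD.
have [|c c0 cP] := roth 32^-1; first by rewrite invr_gt0.
have [|||||||n0 hn0] := @short_repetitions R (repr alpha) (repr beta) (repr gamma) c L a b eta S.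
- by [].
- exact: c0.
- move=> t t0; apply: ltW; apply: lt_le_trans (cP t t0) _.
  rewrite -[X in circle_norm (X *+ _)]reprK -raddfMn circle_normE mulr_natr.
  exact: lexx.
- by [].
- by rewrite -lenE.
- by [].
- by [].
exists n0 => n m n0n same; apply: hn0 n0n _ _ => [k km|k z km Sab].
  have [l _ Jl] : cover [set: 'I_N] J (\pi_(circle R) (S k)) by case: part => ->.
  have Jl' : J l (\pi_(circle R) (S (k + n)%N)).
    by rewrite -lift; apply: quad_coding_same_cell (same k km) _; rewrite ?lift.
  have [z zl] := circle_arc_diff (lenP l).1 Jl Jl'.
  by exists z; apply: le_trans zl (lenL l).
have Jl : J l0 (\pi_(circle R) (S k)).
  rewrite JE; exists (S k - z%:~R); first exact: interval_openW.
  by rewrite -mulrNz circle_addz.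
have : J l0 (\pi_(circle R) (S (k + n)%N)).
  by rewrite -lift; apply: quad_coding_same_cell (same k km) _; rewrite ?lift.
rewrite JE => -[x /= /interval_closedW xab /circle_eq_lift[z' xE]].
by exists (- z'); rewrite mulrNz opprK -xE.
Qed.

Theorem theorem7 (R : realType) (K : numFieldType) (N : nat)
    (J : 'I_N -> set (circle R)) (lam : 'I_N -> K) (alpha : circle R)
    (J_partition : partition [set: 'I_N] J [set: circle R])
    (J_short : forall l : 'I_N, exists2 len : R, circle_arc (J l) len & len < 2^-1)
    (lam_inj : injective lam)
    (alpha_Roth : Roth_number alpha) :
  forall beta gamma : circle R,
    rep R (quad_coding lam J alpha beta gamma) = 1%E /\
    pinned_rep R (quad_coding lam J alpha beta gamma) = 1%E.
Proof.
move=> beta gamma.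
have small := @quad_coding_short_repetitions R K N J lam alpha beta gamma
  J_partition J_short lam_inj alpha_Roth.
split; apply: sup_growth_eq1 => eta /small[n0 hn0]; exists n0 => n m n0n [_ mP].
  exact: hn0.
by apply: hn0 => // k /mP[].
Qed.
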